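(* For any finite graph $G$, the altermatic number of the Mycielskian $M(G)$ satisfies $\zeta(M(G))\geq\zeta(G)+1$.
   Context: Graphs are finite, simple, undirected, with nonempty vertex set. A hypergraph $\mathcal{H}=(V(\mathcal{H}),E(\mathcal{H}))$ consists of a nonempty finite vertex set $V(\mathcal{H})$ and a set $E(\mathcal{H})$ of distinct nonempty subsets of $V(\mathcal{H})$ (isolated vertices and singleton edges are allowed). The general Kneser graph ${\rm KG}(\mathcal{H})$ has vertex set $E(\mathcal{H})$, two vertices being adjacent iff the corresponding edges are disjoint. A homomorphism $G\to H$ of graphs is an adjacency-preserving map $V(G)\to V(H)$. Write $G\longleftrightarrow H$ (homomorphically equivalent) if there are homomorphisms $G\to H$ and $H\to G$. For $X=(x_1,\dots,x_n)\in\{-1,0,+1\}^n$, the alternation number $alt(X)$ is the length of a longest subsequence of nonzero entries of $X$ in which any two consecutive terms have opposite signs; $alt((0,\dots,0))=0$. For a set $V$ of size $n$ let $L_V$ be the set of linear orderings of $V$; for $\sigma\in L_V$ let $\sigma(j)$ be the $j$-th element of $V$ in the ordering $\sigma$, and put $X^+_\sigma=\{\sigma(j): x_j=+1\}$ and $X^-_\sigma=\{\sigma(j): x_j=-1\}$. For a hypergraph $\mathcal{H}$ with $n=|V(\mathcal{H})|$ and $\sigma\in L_{V(\mathcal{H})}$: $alt_\sigma(\mathcal{H})$ is the largest integer $k$ such that there is $X\in\{-1,0,+1\}^n$ with $alt(X)=k$ such that neither $X^+_\sigma$ nor $X^-_\sigma$ contains (as a subset) an edge of $\mathcal{H}$.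 Set $alt(\mathcal{H})=\min_{\sigma\in L_{V(\mathcal{H})}} alt_\sigma(\mathcal{H})$. The altermatic number of a graph $G$ is $$\zeta(G)=\max_{\mathcal{H}}\{|V(\mathcal{H})|-alt(\mathcal{H}): {\rm KG}(\mathcal{H})\longleftrightarrow G\},$$ the maximum being over all hypergraphs $\mathcal{H}$ with ${\rm KG}(\mathcal{H})\longleftrightarrow G$. (The maximum exists: it is a known theorem that it is bounded above by the chromatic number $\chi(G)$.) For a graph $G$ with vertex set $\{u_1,\dots,u_n\}$, the Mycielskian $M(G)$ is the graph with vertex set $\{u_1,\dots,u_n,v_1,\dots,v_n,w\}$ and edge set $E(G)\cup\{u_iv_j: u_iu_j\in E(G)\}\cup\{wv_i:1\leq i\leq n\}$. *)

(* Defs.v *)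
From HB Require Import structures.
From mathcomp Require Import boolp classical_sets constructive_ereal.
From mathcomp Require Import all_boot all_order all_algebra.

Set Implicit Arguments.
Unset Strict Implicit.
Unset Printing Implicit Defensive.

Import Order.TTheory GRing.Theory Num.Theory.

Local Open Scope ring_scope.

(* The vertex set may be empty: the Kneser graph of a hypergraph without edges *)
(* is the null graph. Nonemptiness is a separate hypothesis where needed.      *)
Record sgraph := SGraph {
  vertex :> finType;
  adj : rel vertex;
  adj_sym : symmetric adj;
  adj_irr : irreflexive adj }.

Definition hom (G H : sgraph) : Prop :=
  exists f : G -> H, forall x y : G, adj x y -> adj (f x) (f y).

Definition hom_equiv (G H : sgraph) : Prop := hom G H /\ hom H G.

Record hypergraph := Hypergraph {
  hvertex :> finType;
  hedges : {set {set hvertex}};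
  hvertex_gt0 : (0 < #|hvertex|)%N;
  hedges_neq0 : set0 \notin hedges }.

Section Kneser.
Variable H : hypergraph.

Definition kneser_vertex : finType := {A : {set H} | A \in hedges H}.

Definition kneser_adj : rel kneser_vertex :=
  fun A B => [disjoint val A & val B].

Lemma kneser_adj_sym : symmetric kneser_adj.
Proof. by move=> A B; rewrite /kneser_adj disjoint_sym. Qed.

Lemma kneser_adj_irr : irreflexive kneser_adj.
Proof.
move=> A; apply/negbTE; rewrite /kneser_adj -setI_eq0 setIid.
by apply: contraNneq (hedges_neq0 H) => <-; exact: valP.
Qed.

Definition kneser : sgraph := SGraph kneser_adj_sym kneser_adj_irr.
End Kneser.

(* The set {-1, 0, +1} of signs is represented by the three elements -1, 0, 1  *)
(* of 'F_3, of which only the opposite is used.                                *)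
Definition alternating (s : seq 'F_3) : bool :=
  all (fun x => x != 0) s && sorted (fun x y => y == - x) s.

Definition alt_vec (n : nat) (X : n.-tuple 'F_3) : nat :=
  \max_(m : n.-tuple bool | alternating (mask m X)) size (mask m X).

Definition orderings (V : finType) : {set #|V|.-tuple V} :=
  [set s : #|V|.-tuple V | uniq s]%SET.

(* X^+_sigma for a = 1 and X^-_sigma for a = -1 *)
Definition sign_part (V : finType) (sigma : #|V|.-tuple V)
    (X : #|V|.-tuple 'F_3) (a : 'F_3) : {set V} :=
  [set tnth sigma j | j : 'I_#|V| & tnth X j == a]%SET.

Definition contains_edge (H : hypergraph) (S : {set H}) : bool :=
  [exists A in hedges H, A \subset S].

Definition alt_ord (H : hypergraph) (sigma : #|H|.-tuple H) : nat :=
  \max_(X : #|H|.-tuple 'F_3 | ~~ contains_edge (sign_part sigma X 1) &&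
                               ~~ contains_edge (sign_part sigma X (-1)))
    alt_vec X.

(* The default value #|H| bounds every alt_ord sigma, so that it does not      *)
(* affect the minimum.                                                         *)
Definition alt (H : hypergraph) : nat :=
  \big[minn/#|H|]_(sigma in orderings H) alt_ord sigma.

Definition altermatic_values (G : sgraph) : set int :=
  [set k : int | exists H : hypergraph,
     hom_equiv (kneser H) G /\ k = #|H|%:Z - (alt H)%:Z]%classic.

(* The maximum of altermatic_values G. It exists: every graph is a Kneser      *)
(* graph, and the values are at most the chromatic number of G. The default    *)
(* +oo, the natural value for an unbounded set, only makes the definition      *)
(* total without a proof of that bound.                                        *)
Definition zeta (G : sgraph) : \bar int :=
  xget +oo%E
    [set m%:E | m in
       altermatic_values G `&` ubound (altermatic_values G)]%classic.

Lemma zeta_max (G : sgraph) (m : int) :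
  altermatic_values G m -> ubound (altermatic_values G) m -> zeta G = m%:E.
Proof.
move=> Gm ubm; apply: xget_unique; first by exists m.
move=> _ [p [Gp ubp] <-]; congr (_%:E).
by apply/le_anti; rewrite (ubm _ Gp) (ubp _ Gm).
Qed.

(* The vertices u_i, v_i and w are Some (inl i), Some (inr i) and None.        *)
Section Mycielskian.
Variable G : sgraph.

Definition mycielskian_adj : rel (option (G + G)) := fun x y =>
  match x, y with
  | Some (inl i), Some (inl j) => adj i j
  | Some (inl i), Some (inr j) => adj i j
  | Some (inr i), Some (inl j) => adj i j
  | Some (inr _), None => true
  | None, Some (inr _) => true
  | _, _ => false
  end.

Lemma mycielskian_adj_sym : symmetric mycielskian_adj.
Proof. by move=> [[i|i]|] [[j|j]|] //=; rewrite adj_sym. Qed.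

Lemma mycielskian_adj_irr : irreflexive mycielskian_adj.
Proof. by move=> [[i|i]|] //=; rewrite adj_irr. Qed.

Definition mycielskian : sgraph :=
  SGraph mycielskian_adj_sym mycielskian_adj_irr.
End Mycielskian.

(* Main.v *)
(* Let H be a hypergraph on n vertices whose Kneser graph K is equivalent to G. *)
(* Add to H the disjoint sets O and E of size m = 2n+1, and take as edges      *)
(* - u_A : A + o, for A an edge of H and o in O;                               *)
(* - v_A : A + Q, for A an edge of H and Q a majority of E;                    *)
(* - w   : O.                                                                  *)
(* Two majorities of E meet, so this represents the Mycielskian of K. Order    *)
(* the new vertices as o_1 e_1 o_2 e_2 ... after an optimal ordering of H, and *)
(* let X have no edge in X^+ or X^-. If there is no edge of H either, then X   *)
(* does not alternate on all of O + E, for otherwise O would lie in X^+ or in  *)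
(* X^-. If X^+, say, contains an edge of H, then it has at most n elements in  *)
(* O + E, so that X alternates at most 2n+1 times there. In both cases         *)
(* alt X <= alt H + 2m - 1, whereas there are n + 2m vertices.                 *)
Require Import Defs.
From mathcomp Require Import boolp classical_sets constructive_ereal.
From mathcomp Require Import all_boot all_order all_algebra.
From mathcomp Require Import zify.

Import Order.TTheory GRing.Theory Num.Theory.
Local Open Scope ring_scope.

Set Implicit Arguments.
Unset Strict Implicit.
Unset Printing Implicit Defensive.

(** It suffices to turn every hypergraph that represents [G] into one that represents the
    Mycielskian and whose value is larger by at least 1 ([altermatic_values_mycielskian]). The
    construction above does this: its Kneser graph is equivalent to the Mycielskian of [kneser H]
    ([kneser_mycielskian_hypergraph]), hence to that of [G] ([hom_mycielskian]), and [2m] new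
    vertices raise [alt] by at most [2m - 1] ([alt_mycielskian_hypergraph]). The latter combines
    [alternating_pairs], when no sign class contains an edge of [H], with [alternating_count], when
    one does. *)

(** * Alternation in sequences of signs *)

Definition alt_le (s : seq 'F_3) (k : nat) : Prop :=
  forall t, subseq t s -> alternating t -> (size t <= k)%N.

Lemma alternating_cat (s t : seq 'F_3) :
  alternating (s ++ t) -> alternating s /\ alternating t.
Proof.
rewrite /alternating all_cat => /andP[/andP[-> ->]] /=.
by move=> /cat_sorted2[-> ->].
Qed.

Lemma alt_le_cat (s t : seq 'F_3) (k l : nat) :
  alt_le s k -> alt_le t l -> alt_le (s ++ t) (k + l).
Proof.
move=> sk tl r /subseqP[b sz_b ->].
have sz : size (take (size s) b) = size s.
  by rewrite size_takel // sz_b size_cat leq_addr.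
rewrite -(cat_take_drop (size s) b) mask_cat // => /alternating_cat[alt1 alt2].
by rewrite size_cat leq_add ?sk ?tl ?mask_subseq.
Qed.

Lemma alt_le_size (s : seq 'F_3) : alt_le s (size s).
Proof. by move=> t /size_subseq. Qed.

Lemma alt_le_predn (s : seq 'F_3) : ~~ alternating s -> alt_le s (size s).-1.
Proof.
move=> nalt t ts alt_t; have [le_ts eq_ts] := size_subseq_leqif ts.
rewrite -ltnS; apply: leq_trans (leqSpred _); rewrite ltn_neqAle le_ts eq_ts.
by rewrite andbT; apply: contraNneq nalt => <-.
Qed.

Lemma F3_opp (a x : 'F_3) : a != 0 -> x != 0 -> (a == x) || (a == - x).
Proof. by case: a => -[|[|[|]]] // ?; case: x => -[|[|[|]]]. Qed.

(** Of two consecutive terms, which are opposite and nonzero, one is [a]. Removing terms two at a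
    time leaves at most one, whence the extra 1. *)
Lemma alternating_count (a : 'F_3) (s : seq 'F_3) :
  a != 0 -> alternating s -> (size s <= (count_mem a s).*2.+1)%N.
Proof.
move=> a0; have [n] := ubnP (size s).
elim: n s => // n IHn [|x [|y s]] //= /ltnSE sz_s.
rewrite /alternating /= => /andP[/and3P[x0 y0 s0] /andP[/eqP yx /path_sorted ss]].
have {}IHn : (size s <= (count_mem a s).*2.+1)%N.
  by apply: IHn; rewrite ?(ltnW sz_s) // /alternating s0 ss.
have := F3_opp a0 x0; rewrite -yx (eq_sym x) (eq_sym y).
move: IHn; move: (count _ s) (size s) => c k.
by case: (a == x); case: (a == y) => //= IHn _; rewrite !doubleD /=; lia.
Qed.

Lemma alt_le_count (a : 'F_3) (s : seq 'F_3) :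
  a != 0 -> alt_le s (count_mem a s).*2.+1.
Proof.
move=> a0 t ts /(alternating_count a0)/leq_trans; apply.
by rewrite ltnS leq_double leq_count_subseq.
Qed.

(** * Bounds for [alt_vec], [alt_ord] and [alt]; interleaved pairs *)

Lemma alt_vec_leP (n : nat) (X : n.-tuple 'F_3) (k : nat) :
  (alt_vec X <= k)%N <-> alt_le X k.
Proof.
split=> [/bigmax_leqP leXk t /subseqP[b sz_b ->] | leXk].
  have sz : size b == n by rewrite sz_b size_tuple.
  exact: (leXk (Tuple sz)).
by apply/bigmax_leqP => b alt_b; apply: leXk; rewrite ?mask_subseq.
Qed.

(** Signs indexed by vertices instead of positions have classes independent of the ordering, and
    restrict directly to the old and the new vertices of an enlarged hypergraph. *)
Lemma alt_ord_leP (H : hypergraph) (sigma : #|H|.-tuple H) (k : nat) :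
  uniq sigma ->
  (alt_ord sigma <= k)%N <->
  (forall f : H -> 'F_3,
     (forall a, a != 0 -> ~~ contains_edge [set x | f x == a]%SET) ->
     alt_le (map f sigma) k).
Proof.
move=> us.
have mem_s x : x \in sigma.
  have sz_s : #|sigma| = #|H| by rewrite (card_uniqP us) size_tuple.
  by have /(subset_cardP sz_s)-> := subset_predT (mem sigma).
have part_s (f : H -> 'F_3) a :
    sign_part sigma (map_tuple f sigma) a = [set x | f x == a]%SET.
  apply/setP=> x; rewrite inE; apply/imsetP/idP => [[j]|fx].
    by rewrite inE tnth_map => fj ->.
  by have /tnthP[j xE] := mem_s x; exists j; rewrite // inE tnth_map -xE.
split=> [/bigmax_leqP le_k f nof | le_k].
  by apply/(alt_vec_leP (map_tuple f sigma))/le_k; rewrite !part_s !nof.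
apply/bigmax_leqP => X /andP[no1 noN1]; apply/alt_vec_leP.
pose f x := nth 0 X (index x sigma).
have XE : X = map_tuple f sigma.
  apply: eq_from_tnth => j; rewrite tnth_map /f (tnth_nth (tnth sigma j)).
  by rewrite index_uniq ?size_tuple // -tnth_nth.
rewrite XE; apply: le_k => a a0; rewrite -part_s -XE.
by have /orP[/eqP->|/eqP->] := F3_opp a0 (oner_neq0 _).
Qed.

(** Terms two places apart in an alternating sequence agree. For [o_1 e_1 o_2 e_2 ...] this puts all
    of [O] in one sign class. *)
Lemma alternating_pairs (I : Type) (f g : I -> 'F_3) (r : seq I) :
  alternating (flatten [seq [:: f i; g i] | i <- r]) ->
  exists2 a, a != 0 & all (fun i => f i == a) r.
Proof.
case: r => [|i r] /=; first by exists 1.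
rewrite /alternating /= => /andP[/and3P[fi0 _ _] /andP[/eqP-> pr]].
exists (f i) => //; rewrite eqxx /=; move: pr.
elim: r => //= j r IHr; rewrite opprK => /and3P[/eqP-> /eqP->].
by rewrite eqxx /=.
Qed.

Lemma count_pairs (I : finType) (a : 'F_3) (f g : I -> 'F_3) (r : seq I) :
  (forall i, f i != a) ->
  count_mem a (flatten [seq [:: f i; g i] | i <- r]) = count (fun i => g i == a) r.
Proof. by move=> fa; elim: r => //= i r ->; rewrite (negbTE (fa i)). Qed.

Lemma alt_leq (H : hypergraph) (sigma : #|H|.-tuple H) :
  uniq sigma -> (alt H <= alt_ord sigma)%N.
Proof.
move=> us; have : sigma \in orderings H by rewrite inE.
rewrite /alt; have : sigma \in index_enum {: #|H|.-tuple H} by rewrite mem_index_enum.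
elim: (index_enum _) => // tau r IHr; rewrite inE big_cons => /predU1P[<-|rs] os.
  by rewrite os geq_minl.
by case: ifP => _; rewrite ?geq_min ?IHr ?orbT.
Qed.

Lemma alt_attained (H : hypergraph) :
  exists2 sigma : #|H|.-tuple H, uniq sigma & (alt_ord sigma <= alt H)%N.
Proof.
rewrite /alt; apply: (big_ind (fun k => exists2 sigma : #|H|.-tuple H,
  uniq sigma & (alt_ord sigma <= k)%N)) => [|k l Hk Hl|sigma].
(* The default [#|H|] of the minimum bounds [alt_ord] of any ordering. *)
- exists (enum_tuple H); first exact: enum_uniq.
  apply/alt_ord_leP => [|f _]; first exact: enum_uniq.
  by rewrite -[X in alt_le _ X](size_tuple (map_tuple f (enum_tuple H))); apply: alt_le_size.
- by case: (leqP k l).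
- by rewrite inE => us; exists sigma.
Qed.

(** * Homomorphisms and Mycielskians *)

Lemma hom_trans (G H K : sgraph) : Defs.hom G H -> Defs.hom H K -> Defs.hom G K.
Proof. by move=> [f fP] [g gP]; exists (fun x => g (f x)) => x y /fP/gP. Qed.

Lemma hom_mycielskian (G H : sgraph) :
  Defs.hom G H -> Defs.hom (mycielskian G) (mycielskian H).
Proof.
move=> [f fP]; exists (fun x : mycielskian G => match x with
  | Some (inl i) => Some (inl (f i))
  | Some (inr i) => Some (inr (f i))
  | None => None
  end : mycielskian H).
by case=> [[i|i]|] [[j|j]|] //; apply: fP.
Qed.

(** * Representation of a graph as a Kneser graph *)

Section KneserRepresentation.
Variables (G : sgraph) (hG : (0 < #|G|)%N).

(** The pair [(v, v)] makes it nonempty, and [(u, v)] lies in both [star u] and [star v] exactly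
    when [u] and [v] are not adjacent. *)
Definition star (v : G) : {set G * G} :=
  [set p | ((p.1 == v) || (p.2 == v)) && ~~ adj p.1 p.2]%SET.

Lemma star_disjoint (u v : G) : [disjoint star u & star v] = adj u v.
Proof.
apply/idP/idP => [/pred0P/(_ (u, v))|uv].
  by rewrite /= !inE /= !eqxx orbT /= andbb => /negbFE.
apply/pred0P => -[x y] /=; rewrite !inE /=; apply/negP.
move=> /andP[/andP[xyu nxy] /andP[xyv _]]; move: nxy.
case/orP: xyu xyv => /eqP-> /orP[] /eqP e.
- by move: uv; rewrite e adj_irr.
- by rewrite e uv.
- by rewrite e adj_sym uv.
- by move: uv; rewrite e adj_irr.
Qed.

Definition star_hypergraph : hypergraph.
Proof.
refine (@Hypergraph (G * G)%type [set star v | v in G]%SET _ _).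
  by rewrite card_prod muln_gt0 hG.
apply/imsetP => -[v _ /esym/setP/(_ (v, v))].
by rewrite !inE eqxx adj_irr.
Defined.

Lemma kneser_star : hom_equiv (kneser star_hypergraph) G.
Proof.
split; last first.
  have starP v : star v \in hedges star_hypergraph by apply/imsetP; exists v.
  exists (fun v => exist _ (star v) (starP v)) => u v uv.
  by rewrite /adj /= /kneser_adj /= star_disjoint.
have /fin_all_exists[f fP] (A : kneser star_hypergraph) :
    exists v, val A = star v.
  by have /imsetP[v _ ->] := valP A; exists v.
by exists f => A B; rewrite {1}/adj /= /kneser_adj !fP star_disjoint.
Qed.
End KneserRepresentation.

(** * The hypergraph that represents the Mycielskian *)

Section MycielskianHypergraph.
Variable H : hypergraph.
Let n := #|H|.
Let m := n.*2.+1.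
Let K := kneser H.

(* (i, true) and (i, false) are o_i and e_i. The edges are the upward closure  *)
(* of those described above, and may carry several vertices of the Mycielskian *)
(* of K, any of which is a suitable image for the homomorphism.                *)
Definition carries (S : {set H + 'I_m * bool}) (y : mycielskian K) : bool :=
  match y with
  | Some (inl A) => [forall x in val A, inl x \in S] &&
                    [exists i, inr (i, true) \in S]
  | Some (inr A) => [forall x in val A, inl x \in S] &&
                    (n < #|[set i | inr (i, false) \in S]%SET|)%N
  | None => [forall i, inr (i, true) \in S]
  end.

Lemma carries_neq0 (y : mycielskian K) : ~~ carries set0 y.
Proof.
case: y => [[A|A]|] /=.
- by rewrite negb_and orbC; apply/orP; left; apply/existsPn => i; rewrite inE.
- rewrite negb_and orbC -leqNgt (_ : [set i | _]%SET = set0) ?cards0 //.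
  by apply/setP => i; rewrite !inE.
- by apply/forallPn; exists ord0; rewrite inE.
Qed.

Definition mycielskian_hypergraph : hypergraph.
Proof.
refine (@Hypergraph (H + 'I_m * bool)%type
  [set S | [exists y, carries S y]]%SET _ _).
  by rewrite card_sum addn_gt0 hvertex_gt0.
by rewrite inE; apply/existsPn => y; apply: carries_neq0.
Defined.

Lemma card_mycielskian_hypergraph : #|mycielskian_hypergraph| = (n + m.*2)%N.
Proof. by rewrite /= card_sum card_prod card_ord card_bool muln2. Qed.

Lemma carries_contains_edge (S : {set mycielskian_hypergraph}) (y : mycielskian K) :
  carries S y -> contains_edge S.
Proof.
by move=> Sy; apply/exists_inP; exists S; rewrite ?inE //; apply/existsP; exists y.
Qed.

Lemma carries_adj (S T : {set H + 'I_m * bool}) (y z : mycielskian K) :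
  [disjoint S & T] -> carries S y -> carries T z -> adj y z.
Proof.
move=> dST.
have nST x : x \in S -> x \in T -> False.
  by move=> xS; rewrite (disjointFr dST xS).
have dis (A B : K) : [forall x in val A, inl x \in S] ->
    [forall x in val B, inl x \in T] -> adj A B.
  move=> /forall_inP AS /forall_inP BT; apply/pred0P => x /=.
  by apply/negP => /andP[/AS xS /BT]; apply: nST.
case: y z => [[A|A]|] [[B|B]|] //= => [/andP[AS _]|/andP[AS _]| |/andP[AS _]| | |].
- by move=> /andP[/(dis _ _ AS)].
- by move=> /andP[/(dis _ _ AS)].
- by move=> /andP[_ /existsP[i iS]] /forallP/(_ i)/(nST _ iS).
- by move=> /andP[/(dis _ _ AS)].
(* Two vertices [v_A] and [v_B]: each set has more than [n] of the [2n+1] elements of [E], so they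
   meet. *)
- move=> /andP[_ nS] /andP[_ nT].
  set S' := [set i | _]%SET in nS; set T' := [set i | _]%SET in nT.
  have := cardsUI S' T'; rewrite (_ : S' :&: T' = set0)%SET; last first.
    by apply/setP => i; rewrite !inE; apply/negP => /andP[/nST].
  have := max_card (mem (S' :|: T')%SET); rewrite card_ord cards0 addn0 /m.
  move: nS nT; move: (#|S'|) (#|T'|) (#|_|) => a b c; lia.
- by move=> /forallP iS /andP[_ /existsP[i iT]]; case: (nST _ (iS i) iT).
- by move=> /forallP/(_ ord0) iS /forallP/(_ ord0) /(nST _ iS).
Qed.

Lemma kneser_mycielskian_hypergraph :
  hom_equiv (kneser mycielskian_hypergraph) (mycielskian K).
Proof.
split.
  have /fin_all_exists[f fP] (S : kneser mycielskian_hypergraph) :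
      exists y, carries (val S) y.
    by have := valP S; rewrite inE => /existsP.
  by exists f => S T /carries_adj; apply.
(* The image of [u_A] contains a single [o], which must differ for disjoint edges. It is indexed by
   a vertex of [A], which is possible as [n <= m]. *)
have /fin_all_exists[rep repP] (A : K) : exists x, x \in val A.
  apply/set0Pn; apply: contraNneq (hedges_neq0 H) => <-; exact: valP.
have lenm : (n <= m)%N by rewrite /m; lia.
pose idx x := widen_ord lenm (enum_rank x).
have idxI : injective idx.
  by move=> x y /(congr1 val) /= /ord_inj/enum_rank_inj.
pose supp (y : mycielskian K) : {set H + 'I_m * bool} := [set z |
  match y, z with
  | Some (inl A), inl x => x \in val A
  | Some (inl A), inr (i, b) => b && (i == idx (rep A))
  | Some (inr A), inl x => x \in val A
  | Some (inr _), inr (_, b) => ~~ b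
  | None, inl _ => false
  | None, inr (_, b) => b
  end]%SET.
have suppP y : carries (supp y) y.
  case: y => [[A|A]|] /=.
  - apply/andP; split; first by apply/forall_inP => x; rewrite inE.
    by apply/existsP; exists (idx (rep A)); rewrite inE eqxx.
  - apply/andP; split; first by apply/forall_inP => x; rewrite inE.
    rewrite (_ : [set i | _]%SET = setT) ?cardsT ?card_ord /m; first by lia.
    by apply/setP => i; rewrite !inE.
  - by apply/forallP => i; rewrite inE.
have supp_edge y : supp y \in hedges mycielskian_hypergraph.
  by rewrite inE; apply/existsP; exists y.
exists (fun y => exist _ (supp y) (supp_edge y)) => y z yz.
rewrite /adj /= /kneser_adj /=; apply/pred0P => x /=; apply/negP.
rewrite !inE; case: y z yz => [[A|A]|] [[B|B]|] //=; case: x => [x|[i b]] //.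
- by move=> /pred0P/(_ x)/= ->.
- move=> dAB /andP[/andP[_ /eqP->] /andP[_ /eqP/idxI repE]].
  by have /pred0P/(_ (rep A)) := dAB; rewrite /= repP repE repP.
- by move=> /pred0P/(_ x)/= ->.
- by case: b; rewrite /= ?andbF.
- by move=> /pred0P/(_ x)/= ->.
- by case: b.
- by rewrite andbF.
- by case: b.
- by case: b.
Qed.

(** * The interleaved ordering and its alternation number *)

Let pairs : seq ('I_m * bool) := [seq (i, b) | i <- enum 'I_m, b <- [:: true; false]].

Let size_pairs : size pairs = m.*2.
Proof. by rewrite size_allpairs size_enum_ord muln2. Qed.

Let uniq_pairs : uniq pairs.
Proof. by rewrite allpairs_uniq ?enum_uniq // => -[i b] [j c]. Qed.

Let map_pairs (f : 'I_m * bool -> 'F_3) :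
  map f pairs = flatten [seq [:: f (i, true); f (i, false)] | i <- enum 'I_m].
Proof. by rewrite map_flatten -map_comp. Qed.

Definition extend_ordering (sigma : seq H) : seq mycielskian_hypergraph :=
  map inl sigma ++ map inr pairs.

Lemma extend_ordering_uniq (sigma : seq H) : uniq sigma -> uniq (extend_ordering sigma).
Proof.
move=> us; rewrite cat_uniq !map_inj_uniq ?us ?uniq_pairs /= ?andbT; last 2 first.
- by move=> ? ? [].
- by move=> ? ? [].
by apply/hasPn => _ /mapP[t _ ->]; apply/mapP => -[].
Qed.

Lemma extend_ordering_size (sigma : #|H|.-tuple H) :
  size (extend_ordering sigma) == #|mycielskian_hypergraph|.
Proof.
by rewrite card_mycielskian_hypergraph size_cat !size_map size_pairs size_tuple.
Qed.

Lemma alt_mycielskian_hypergraph :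
  (alt mycielskian_hypergraph <= alt H + (m.*2).-1)%N.
Proof.
have [sigma us alt_s] := alt_attained H.
pose tau := Tuple (extend_ordering_size sigma).
have ut : uniq tau by apply: extend_ordering_uniq.
apply: leq_trans (alt_leq ut) _; apply/(alt_ord_leP _ ut) => f nof.
rewrite map_cat -!map_comp.
have nocarry a y : a != 0 -> ~~ carries [set x | f x == a]%SET y.
  by move=> /nof; apply: contra; apply: carries_contains_edge.
have [noV|] := pselect (forall a, a != 0 ->
    ~~ contains_edge [set x : H | f (inl x) == a]%SET).
  apply: alt_le_cat.
    by move/(alt_ord_leP _ us): alt_s; apply.
  rewrite -size_pairs -(size_map (fun x => f (inr x))); apply: alt_le_predn.
  rewrite map_pairs; apply/negP => /alternating_pairs[a a0 /allP allO].
  have /negP[] := nocarry a None a0.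
  by apply/forallP => i; rewrite inE allO ?mem_enum.
move=> /existsNP[a /not_implyP[a0 /negP/negPn/exists_inP[A AH /subsetP A_a]]].
pose A' : K := exist _ A AH.
have inA : [forall x in val A', inl x \in [set x | f x == a]%SET].
  by apply/forall_inP => x /A_a; rewrite !inE.
have noO i : f (inr (i, true)) != a.
  have := nocarry a (Some (inl A')) a0; rewrite /= inA /=.
  by move=> /existsPn/(_ i); rewrite inE.
have fewE : (#|[set i | f (inr (i, false)) == a]%SET| <= n)%N.
  have := nocarry a (Some (inr A')) a0; rewrite /= inA /= -leqNgt.
  by congr (#|pred_of_set _| <= _)%N; apply/setP => i; rewrite !inE.
have cntE : (count_mem a (map (fun x => f (inr x)) pairs) <= n)%N.
  rewrite map_pairs count_pairs //; apply: leq_trans fewE.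
  by rewrite cardsE cardE enumT -size_filter.
(* The trivial bound [n] on the old vertices is enough: [n + (2n+1) <= 4n+1 = 2m-1]. *)
move=> t /(alt_le_cat (@alt_le_size _) (alt_le_count a0)) le_t /le_t{le_t}.
rewrite size_map size_tuple; move: cntE; rewrite -/n /m.
move: (count _ _) => c; lia.
Qed.

End MycielskianHypergraph.

(** * Passage to the maximum *)

Lemma altermatic_values_mycielskian (G : sgraph) (k : int) :
  altermatic_values G k ->
  exists2 l, altermatic_values (mycielskian G) l & k + 1 <= l.
Proof.
move=> [H [[HG GH] ->]]; pose H' := mycielskian_hypergraph H.
exists (#|H'|%:Z - (alt H')%:Z).
  exists H'; split=> //; have [H'K KH'] := kneser_mycielskian_hypergraph H.
  split; first exact: hom_trans H'K (hom_mycielskian HG).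
  exact: hom_trans (hom_mycielskian GH) KH'.
have := alt_mycielskian_hypergraph H; rewrite -/H' card_mycielskian_hypergraph.
move: (alt H') (alt H) => a b; lia.
Qed.

Lemma altermatic_values_nonempty (G : sgraph) :
  (0 < #|G|)%N -> exists k, altermatic_values G k.
Proof. by move=> hG; eexists; exists (star_hypergraph hG); split; first exact: kneser_star. Qed.

(** While [a] is not an upper bound, a larger element of [A] replaces it and the distance to [b]
    drops. *)
Lemma int_ubound_max (A : set int) (a b : int) :
  A a -> ubound A b -> exists2 c, A c & ubound A c.
Proof.
have [k] := ubnP `|b - a|%N; elim: k a => // k IHk a ltk Aa Ab.
have [Aub|] := pselect (ubound A a); first by exists a.
move=> /existsNP[c /not_implyP[Ac /negP]]; rewrite -ltNge => ac.
have := Ab _ Ac => cb.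
by apply: (IHk c) => //; lia.
Qed.

Theorem lemma1 (G : sgraph) (hG : (0 < #|G|)%N) :
  (zeta G + 1%:E <= zeta (mycielskian G))%E.
Proof.
rewrite [leRHS]/zeta; case: xgetP => [_ _ [m [_ ubm] <-]|_]; last by rewrite leey.
have [k Gk] := altermatic_values_nonempty hG.
(* The maximum [m] for the Mycielskian bounds the values for [G]. These therefore have a maximum,
   and [zeta G] is not the default [+oo]. *)
have ubG : ubound (altermatic_values G) (m - 1).
  move=> l /altermatic_values_mycielskian[l' /ubm ml' ll'].
  by rewrite lerBrDr (le_trans ll').
have [p Gp ubp] := int_ubound_max Gk ubG.
rewrite (zeta_max Gp ubp) -EFinD lee_fin -lerBrDr.
exact: ubG.
Qed.
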